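(* Let $\gamma=(\gamma_1,\gamma_2):I_1\to S^3$, $s\mapsto\gamma(s)$, be a unit speed Legendre curve in $S^3$ and let $\alpha=(\alpha_1,\alpha_2):I_2\to H^3_1$, $t\mapsto\alpha(t)$, be a unit speed Legendre curve in $H^3_1$. Consider the map $\phi:I_2\times I_1\subset\mathbf{R}^2\to\mathbf{C}^2=\mathbf{C}\times\mathbf{C}$ defined by $$\phi(t,s)=(\alpha_1(t)\gamma_1(s),\,\alpha_2(t)\gamma_2(s)).$$ Then $\phi$ is a Lagrangian conformal immersion in $\mathbf{C}^2$ such that the induced metric is given by $$\langle\,\cdot\,,\cdot\,\rangle=(|\gamma_1|^2+|\alpha_1|^2)(dt^2+ds^2),$$ and the intrinsic tensor $C(x,y,z)=\langle\sigma(x,y),Jz\rangle$ is given by $$C_{ttt}=\langle\alpha_1'',J\alpha_1'\rangle|\gamma_1|^2+\langle\alpha_2'',J\alpha_2'\rangle|\gamma_2|^2,\qquad C_{tts}=\langle\gamma_1',J\gamma_1\rangle,$$ $$C_{tss}=\langle\alpha_1',J\alpha_1\rangle,\qquad C_{sss}=|\alpha_1|^2\langle\gamma_1'',J\gamma_1'\rangle+|\alpha_2|^2\langle\gamma_2'',J\gamma_2'\rangle,$$ where $C_{ttt}=C(\partial_t,\partial_t,\partial_t)$, $C_{tts}=C(\partial_t,\partial_t,\partial_s)$, and so on.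
   Context: $I_1,I_2\subset\mathbf{R}$ are intervals. On $\mathbf{C}^2$, $(z,w)=z_1\bar w_1+z_2\bar w_2$, $\langle\cdot,\cdot\rangle=\mathrm{Re}\,(\cdot,\cdot)$ is the Euclidean metric, $J$ is the complex structure (multiplication by $i$), and $\omega(\cdot,\cdot)=\langle J\cdot,\cdot\rangle$ is the Kaehler two-form. An immersion $\phi$ of a surface $M$ into $\mathbf{C}^2$ is Lagrangian if $\phi^*\omega=0$. Its second fundamental form is $\sigma$, and in $C(x,y,z)=\langle\sigma(x,y),Jz\rangle$ the tangent vector $z$ is identified with $\phi_*z$. In the formulas involving components of the curves, $J$ is rotation by $+\pi/2$ acting on $\mathbf{C}\equiv\mathbf{R}^2$ and $\langle z,w\rangle=\mathrm{Re}(z\bar w)$ for $z,w\in\mathbf{C}$. $S^3=\{(z,w)\in\mathbf{C}^2:|z|^2+|w|^2=1\}$ is the unit hypersphere. A unit speed Legendre curve $\gamma=(\gamma_1,\gamma_2)$ in $S^3$ is a curve satisfying $|\gamma_1|^2+|\gamma_2|^2=1$, $|\gamma_1'|^2+|\gamma_2'|^2=1$ and $\gamma_1'\bar\gamma_1+\gamma_2'\bar\gamma_2=0$. $H^3_1=\{(z,w)\in\mathbf{C}^2:|z|^2-|w|^2=-1\}$ is the unit anti de Sitter space. A unit speed Legendre curve $\alpha=(\alpha_1,\alpha_2)$ in $H^3_1$ is a curve satisfying $|\alpha_1|^2-|\alpha_2|^2=-1$, $|\alpha_1'|^2-|\alpha_2'|^2=1$ and $\alpha_1'\bar\alpha_1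-\alpha_2'\bar\alpha_2=0$.
   Formalization: Immersion and conformality are claimed only where α1(t), γ1(s) are not both 0: for γ=(sin s,cos s), α=(sinh t,cosh t), dφ vanishes at (0,0). The Lagrangian condition, the metric and the formulas for C hold on all of I2×I1. *)

(* Defs.v *)
From HB Require Import structures.
From mathcomp Require Import all_boot all_order all_algebra.
From mathcomp Require Import complex.
From mathcomp Require Import all_classical all_reals.
From mathcomp Require Import topology normedtype derive.

Set Implicit Arguments.
Unset Strict Implicit.
Unset Printing Implicit Defensive.

Import Order.TTheory GRing.Theory Num.Theory.
Import numFieldNormedType.Exports.

Local Open Scope ring_scope.
Local Open Scope classical_set_scope.

(* [Rcomplex R] is the library's copy of [R[i]] viewed as an algebra over [R]
   with the [R]-valued modulus [`|z|].  The instances below add the topology of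
   that modulus, so that differential calculus over [R] applies to it. *)
Lemma Rcomplex_normrZ (R : realType) (l : R) (x : Rcomplex R) : `|l *: x| = `|l| * `|x|.
Proof.
case: x => a b; rewrite /Num.norm /= !exprMn -mulrDr.
by rewrite sqrtrM ?sqr_ge0 // sqrtr_sqr.
Qed.

HB.instance Definition _ (R : realType) :=
  PseudoMetric.copy (Rcomplex R) (pseudoMetric_normed (Rcomplex R)).
HB.instance Definition _ (R : realType) := isPointed.Build (Rcomplex R) 0.
HB.instance Definition _ (R : realType) :=
  NormedZmod_PseudoMetric_eq.Build R (Rcomplex R) erefl.
HB.instance Definition _ (R : realType) :=
  PseudoMetricNormedZmod_Lmodule_isNormedModule.Build R (Rcomplex R)
    (@Rcomplex_normrZ R).

Section Smooth.
Context {R : realType} {V W : normedModType R}.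

(* [f] is of class C^n in a neighbourhood of [x]; used for finite-dimensional
   [V], where directional derivatives in all directions suffice. *)
Fixpoint Ck_at (n : nat) (f : V -> W) (x : V) : Prop :=
  if n is m.+1 then
    (\forall y \near x, differentiable f y) /\
    (forall v : V, Ck_at m (fun y => 'D_v f y) x)
  else \forall y \near x, {for y, continuous f}.

(* Smoothness on a possibly non-open set: every function here is total, and it
   is required to be smooth in a full neighbourhood of each point of [A].  At an
   endpoint of an interval this is smoothness of some extension, and the
   derivatives there are the one-sided ones. *)
Definition smooth_on (A : set V) (f : V -> W) : Prop :=
  forall x, A x -> forall n, Ck_at n f x.

End Smooth.

Section ComplexPlane.
Context {R : realType}.
Local Notation C := (Rcomplex R).

Definition conjC (z : C) : C := conjc z.

Definition cdot (z w : C) : R := complex.Re (z * conjC w).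
Definition cJ (z : C) : C := (Complex 0 1 : C) * z.

Definition hprod (z w : C * C) : C := z.1 * conjC w.1 + z.2 * conjC w.2.
Definition dot (z w : C * C) : R := complex.Re (hprod z w).
Definition J (z : C * C) : C * C := (cJ z.1, cJ z.2).
Definition omega (z w : C * C) : R := dot (J z) w.

End ComplexPlane.

Section LegendreCurves.
Context {R : realType}.
Local Notation C := (Rcomplex R).

Definition nondegenerate_interval (I : set R) : Prop :=
  is_interval I /\ I° !=set0.

Definition unit_speed_legendre_S3 (I : set R) (g1 g2 : R -> C) : Prop :=
  [/\ smooth_on I g1, smooth_on I g2 &
    forall s, I s ->
    [/\ `|g1 s| ^+ 2 + `|g2 s| ^+ 2 = 1,
        `|derive1 g1 s| ^+ 2 + `|derive1 g2 s| ^+ 2 = 1 &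
        derive1 g1 s * conjC (g1 s) + derive1 g2 s * conjC (g2 s) = 0]].

Definition unit_speed_legendre_H31 (I : set R) (a1 a2 : R -> C) : Prop :=
  [/\ smooth_on I a1, smooth_on I a2 &
    forall t, I t ->
    [/\ `|a1 t| ^+ 2 - `|a2 t| ^+ 2 = -1,
        `|derive1 a1 t| ^+ 2 - `|derive1 a2 t| ^+ 2 = 1 &
        derive1 a1 t * conjC (a1 t) - derive1 a2 t * conjC (a2 t) = 0]].

End LegendreCurves.

Section Surfaces.
Context {R : realType}.
Local Notation C := (Rcomplex R).
Implicit Types (A : set (R * R)) (phi : R * R -> C * C) (p u v w : R * R).

(* Points of the parameter domain are [(t, s)]. *)
Definition dt : R * R := (1, 0).
Definition ds : R * R := (0, 1).

Definition induced_metric phi p u v : R := dot ('d phi p u) ('d phi p v).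

Definition immersion_on A phi : Prop :=
  smooth_on A phi /\ forall p, A p -> injective ('d phi p).

Definition lagrangian_on A phi : Prop :=
  forall p, A p -> forall u v, omega ('d phi p u) ('d phi p v) = 0.

Definition conformal_on A phi : Prop :=
  forall p, A p -> exists2 l : R, 0 < l &
    forall u v, induced_metric phi p u v = l * (u.1 * v.1 + u.2 * v.2).

(* Component of [x] orthogonal to the tangent plane ['d phi p @` setT].  The
   orthogonal decomposition exists and is unique, so the default value [0] of
   [xget] is never reached. *)
Definition normal_part phi p (x : C * C) : C * C :=
  xget 0 [set n : C * C |
    (forall u, dot n ('d phi p u) = 0) /\ (exists u, x = n + 'd phi p u)].

(* Gauss formula in the flat ambient space, with [v] extended to a constant
   coordinate field on the parameter domain. *)
Definition second_fundamental_form phi p u v : C * C :=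
  normal_part phi p ('D_u (fun q => 'd phi q v) p).

Definition cubic_form phi p u v w : R :=
  dot (second_fundamental_form phi p u v) (J ('d phi p w)).

End Surfaces.

(* Main.v *)
Require Import Defs.
From HB Require Import structures.
From mathcomp Require Import all_boot all_order all_algebra.
From mathcomp Require Import complex.
From mathcomp Require Import all_classical all_reals.
From mathcomp Require Import topology normedtype landau derive.
From mathcomp Require Import ring lra.

(** At a point [(t, s)] the coordinate frame of [phi] is
      [X = (a1' g1, a2' g2)],   [Y = (a1 g1', a2 g2')],
    so every product of frame vectors splits, coordinate by coordinate, into a
    factor depending on [alpha] only and one depending on [gamma] only.

    The hermitian product of [X] and [Y] is
      [a1' conj(a1) * g1 conj(g1') + a2' conj(a2) * g2 conj(g2')].
    The Legendre condition makes the two [alpha]-factors equal and the two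
    [gamma]-factors opposite, so it vanishes: its real part gives [X] orthogonal
    to [Y], its imaginary part gives that [phi] is Lagrangian.  Taking moduli in
    the Legendre conditions and using the unit speed equations yields
      [|a1'| = |a2|], [|a2'| = |a1|], [|g1'| = |g2|], [|g2'| = |g1|],
    whence [|X|^2 = |Y|^2 = |g1|^2 + |a1|^2] ([product_map_frame]).

    Since the tangent plane is Lagrangian, [J] maps it into the normal space, so
    in the cubic form the normal projection can be dropped
    ([cubic_form_conformal]) and [C(u, v, w) = <D_u D_v phi, J D_w phi>].  The
    second derivatives of [phi] are again products of a function of [t] and a
    function of [s], and the formulas follow by separating the factors.  Only
    [C_tts] uses more than the relations above: it needs the derivative of the
    Legendre condition of [alpha], which gives
      [a1'' conj(a1) - a2'' conj(a2) = -1].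
    An end point of the interval may be involved there; a differentiable
    function that vanishes on a nondegenerate interval has zero derivative at
    the end points too ([derive1_eq0_interval]).

    What remains is calculus: the classes C^n are stable under the continuous
    bilinear maps and the continuous linear substitutions that build [phi], and
    the complex product and the hermitian product are such bilinear maps. *)

Set Implicit Arguments.
Unset Strict Implicit.
Unset Printing Implicit Defensive.

Import Order.TTheory GRing.Theory Num.Theory.
Import numFieldNormedType.Exports.

Local Open Scope ring_scope.
Local Open Scope classical_set_scope.

(** * Maps of class C^n *)

Section CkCalculus.
Context {R : realType}.
Implicit Types U V W : normedModType R.

(** [f] and [g] have the same first-order expansion at [x], and differentials
    are unique. *)
Lemma near_eq_differentiable V W (f g : V -> W) x :
  (\forall y \near x, f y = g y) -> differentiable f x -> differentiable g x.
Proof.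
move=> fg df.
have g_exp : g \o shift x = cst (g x) + 'd f x +o_ (0 : V) id.
  have := diff_locally df; rewrite (nbhs_singleton fg) => /eqaddoP fo.
  apply/eqaddoP => e e0; have {}fo := fo e e0.
  have fg0 : \forall h \near (0 : V), f (h + x) = g (h + x).
    by have := fg; rewrite (near_shift 0)/= subr0; apply.
  by apply: filterS2 fg0 fo => h fgh /=; rewrite !fctE /= fgh.
have dE : 'd g x = 'd f x :> (V -> W).
  by apply: diff_unique => //; exact: diff_continuous.
apply/diff_locallyP; rewrite dE; split => //; exact: diff_continuous.
Unshelve. all: by end_near. Qed.

Lemma Ck_at_near_eq V W n (f g : V -> W) x :
  (\forall y \near x, f y = g y) -> Ck_at n f x -> Ck_at n g x.
Proof.
elim: n f g => [|n IHn] f g /near_join fg /=.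
  move=> cf; near=> y.
  have fgy : \forall z \near y, f z = g z by near: y.
  apply/(cvg_trans (near_eq_cvg fgy)).
  rewrite -(nbhs_singleton fgy); near: y; exact: cf.
move=> [df Df]; split.
  near=> y; apply: (@near_eq_differentiable _ _ f); near: y; [exact: fg|exact: df].
move=> v; apply: IHn (Df v); near=> y; apply: near_eq_derive; near: y; exact: fg.
Unshelve. all: by end_near. Qed.

Lemma Ck_atW V W n (f : V -> W) x : Ck_at n.+1 f x -> Ck_at n f x.
Proof.
elim: n f => [|n IHn] f /= [df Df].
  by apply: filterS df => y; exact: differentiable_continuous.
by split=> // v; apply: IHn; exact: Df.
Qed.

(** The derivative of the sum is the sum of the derivatives only near [x], where
    both maps are differentiable; [Ck_at_near_eq] bridges the gap, here and in
    the other stability lemmas. *)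
Lemma Ck_atD V W n (f g : V -> W) x :
  Ck_at n f x -> Ck_at n g x -> Ck_at n (fun y => f y + g y) x.
Proof.
elim: n f g => [|n IHn] f g /=.
  move=> cf cg; near=> y; apply: continuousD; near: y; [exact: cf|exact: cg].
move=> [df Df] [dg Dg]; split.
  near=> y; apply: differentiableD; near: y; [exact: df|exact: dg].
move=> v; apply: (@Ck_at_near_eq _ _ _ (fun y => 'D_v f y + 'D_v g y)).
  near=> y; rewrite deriveD//; apply: diff_derivable; near: y;
    [exact: df|exact: dg].
exact: IHn.
Unshelve. all: by end_near. Qed.

Lemma derive_pair V W1 W2 (f : V -> W1) (g : V -> W2) x v :
  differentiable f x -> differentiable g x ->
  'D_v (fun y => (f y, g y)) x = ('D_v f x, 'D_v g x).
Proof.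
by move=> df dg; rewrite !deriveE ?diff_pair//; exact: differentiable_pair.
Qed.

Lemma Ck_at_pair V W1 W2 n (f : V -> W1) (g : V -> W2) x :
  Ck_at n f x -> Ck_at n g x -> Ck_at n (fun y => (f y, g y)) x.
Proof.
elim: n f g => [|n IHn] f g /=.
  move=> cf cg; near=> y; apply: cvg_pair; near: y; [exact: cf|exact: cg].
move=> [df Df] [dg Dg]; split.
  near=> y; apply: differentiable_pair; near: y; [exact: df|exact: dg].
move=> v; apply: (@Ck_at_near_eq _ _ _ (fun y => ('D_v f y, 'D_v g y))).
  near=> y; rewrite derive_pair//; near: y; [exact: df|exact: dg].
exact: IHn.
Unshelve. all: by end_near. Qed.

Lemma derive_comp_linear U V W (f : V -> W) (L : {linear U -> V}) x v :
  continuous L -> differentiable f (L x) ->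
  'D_v (fun y => f (L y)) x = 'D_(L v) f (L x).
Proof.
move=> cL df.
have dL : differentiable L x by exact: linear_differentiable.
rewrite !deriveE//; last exact: (@differentiable_comp _ _ _ _ L f).
by rewrite (@diff_comp _ _ _ _ L f)//= diff_lin.
Qed.

Lemma Ck_at_comp_linear U V W n (f : V -> W) (L : {linear U -> V}) x :
  continuous L -> Ck_at n f (L x) -> Ck_at n (fun y => f (L y)) x.
Proof.
move=> cL; elim: n f => [|n IHn] f /=.
  move=> cf; near=> y; apply: continuous_comp; first exact: cL.
  by near: y; exact: (cL x _ cf).
move=> [df Df]; split.
  near=> y; apply: (@differentiable_comp _ _ _ _ L f).
    by apply: linear_differentiable.
  by near: y; exact: (cL x _ df).
move=> v; apply: (@Ck_at_near_eq _ _ _ (fun y => 'D_(L v) f (L y))).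
  by near=> y; rewrite derive_comp_linear//; near: y; exact: (cL x _ df).
exact: (IHn _ (Df (L v))).
Unshelve. all: by end_near. Qed.

Section Bilinear.
Context {U1 U2 W : normedModType R} {B : {bilinear U1 -> U2 -> W}}.
Context (cB : continuous (fun p : U1 * U2 => B p.1 p.2)).

Lemma differentiable_bilin_comp V (f : V -> U1) (g : V -> U2) x :
  differentiable f x -> differentiable g x ->
  differentiable (fun y => B (f y) (g y)) x.
Proof.
move=> df dg.
apply: (@differentiable_comp _ _ _ _ (fun y => (f y, g y))
  (fun p => B p.1 p.2)); first exact: differentiable_pair.
exact: differentiable_bilin.
Qed.

Lemma derive_bilin V (f : V -> U1) (g : V -> U2) x v :
  differentiable f x -> differentiable g x ->
  'D_v (fun y => B (f y) (g y)) x = B ('D_v f x) (g x) + B (f x) ('D_v g x).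
Proof.
move=> df dg; rewrite !deriveE//; last exact: differentiable_bilin_comp.
rewrite (@diff_comp _ _ _ _ (fun y => (f y, g y)) (fun p => B p.1 p.2)).
- by rewrite /= diff_bilin// diff_pair//= addrC.
- exact: differentiable_pair.
- exact: differentiable_bilin.
Qed.

(** By the Leibniz rule the derivative of [B (f, g)] contains the undifferentiated
    [f] and [g], so the induction needs their lower regularity [Ck_atW]. *)
Lemma Ck_at_bilin V n (f : V -> U1) (g : V -> U2) x :
  Ck_at n f x -> Ck_at n g x -> Ck_at n (fun y => B (f y) (g y)) x.
Proof.
elim: n f g => [|n IHn] f g.
  move=> cf cg; near=> y.
  apply: (@continuous_comp _ _ _ (fun y => (f y, g y))
    (fun p => B p.1 p.2)); last exact: cB.
  apply: cvg_pair; near: y; [exact: cf|exact: cg].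
move=> Cf Cg; have [df Df] := Cf; have [dg Dg] := Cg; split.
  near=> y; apply: differentiable_bilin_comp; near: y; [exact: df|exact: dg].
move=> v; apply: (@Ck_at_near_eq _ _ _
  (fun y => B ('D_v f y) (g y) + B (f y) ('D_v g y))).
  near=> y; rewrite derive_bilin//; near: y; [exact: df|exact: dg].
by apply: Ck_atD; apply: IHn; by [exact: Df|exact: Dg|exact: Ck_atW].
Unshelve. all: by end_near. Qed.

End Bilinear.
End CkCalculus.

Lemma Ck_at1_diff (R : realType) (V W : normedModType R) (f : V -> W) x :
  Ck_at 1 f x -> differentiable f x.
Proof. by move=> [df _]; exact: nbhs_singleton df. Qed.

Lemma Ck_at_derive1 (R : realType) (W : normedModType R) n (f : R -> W) t :
  Ck_at n.+1 f t -> Ck_at n (derive1 f) t.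
Proof.
by move=> [_ /(_ 1)]; congr (Ck_at _ _ _); apply/funext => x; rewrite derive1E.
Qed.

(** * Functions vanishing on an interval *)

(** The interval supplies another point [c], and the points of the segment from
    [t] to [c] near [t] have difference quotient [0]; so a nonzero limit of the
    difference quotients is impossible, even if [t] is an end point. *)
Lemma derive1_eq0_interval (R : realType) (W : normedModType R) (I : set R)
    (h : R -> W) t :
  nondegenerate_interval I -> I t -> (forall x, I x -> h x = 0) ->
  derivable h t 1 -> h^`() t = 0.
Proof.
move=> [Iitv [c0 Ic0]] It h0 dh.
have [c Ic ct] : exists2 c, I c & c != t.
  have [c0t|] := eqVneq c0 t; last by exists c0 => //; exact: interior_subset.
  move: Ic0; rewrite /interior => /nbhs_ballP[e /= e0 /(_ (c0 + e / 2))] Ie.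
  exists (c0 + e / 2); last by rewrite c0t; lra.
  by apply: Ie; rewrite /ball/= opprD addNKr normrN gtr0_norm; lra.
apply/eqP/negPn/negP => h'0.
have /cvgrPdist_lt /(_ `|h^`() t|) := dh.
rewrite normr_gt0 => /(_ h'0).
rewrite -[lim _]/('D_1 h t) -derive1E => /nbhs_ballP[d /= d0 hd].
pose m := Num.min 1 (d / 2 / `|c - t|).
have ct0 : 0 < `|c - t| by rewrite normr_gt0 subr_eq0.
have m0 : 0 < m by rewrite lt_min ltr01 !divr_gt0.
have m1 : m <= 1 by rewrite ge_min lexx.
have md : m * `|c - t| < d.
  apply: (@le_lt_trans _ _ (d / 2)); last lra.
  by rewrite -ler_pdivlMr// ge_min lexx orbT.
have Im : I (m * (c - t) + t).
  have [ltct|lttc|/eqP] := ltgtP c t; last by rewrite (negbTE ct).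
  - by apply: (Iitv c t) => //; apply/andP; split; nra.
  - by apply: (Iitv t c) => //; apply/andP; split; nra.
have := hd (m * (c - t)).
rewrite /ball/= sub0r normrN normrM (gtr0_norm m0) => /(_ md).
rewrite (mulf_neq0 (lt0r_neq0 m0)) ?subr_eq0// => /(_ isT).
by rewrite [_%:A]mulr1 (h0 _ Im) (h0 _ It) subrr scaler0 subr0 ltxx.
Qed.

(** * Products on the complex plane *)

Lemma bounded_bilinear_continuous (R : realType) (U V W : normedModType R)
    (B : {bilinear U -> V -> W}) :
  (forall u v, `|B u v| <= `|u| * `|v|) ->
  continuous (fun p : U * V => B p.1 p.2).
Proof.
move=> leB [u0 v0]; apply/cvgrPdist_le => /= e e0.
(* the summand [1] bounds the distance from [p.2] to [v0] *)
pose k := `|u0| + `|v0| + 1.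
have k0 : 0 < k by rewrite /k; have := normr_ge0 u0; have := normr_ge0 v0; lra.
have ek0 : 0 < e / k by rewrite divr_gt0.
have c1 : (fun p : U * V => p.1) @ (u0, v0) --> u0 by exact: cvg_fst.
have c2 : (fun p : U * V => p.2) @ (u0, v0) --> v0 by exact: cvg_snd.
near=> p.
have up : `|u0 - p.1| <= e / k.
  by near: p; move/cvgrPdist_le: c1; apply.
have vp : `|v0 - p.2| <= e / k.
  by near: p; move/cvgrPdist_le: c2; apply.
have vp1 : `|v0 - p.2| <= 1.
  by near: p; move/cvgrPdist_le: c2; apply.
have -> : B u0 v0 - B p.1 p.2 = B (u0 - p.1) p.2 + B u0 (v0 - p.2).
  by rewrite linearBl linearBr /= [RHS]addrC addrA subrK.
have p2 : `|p.2| <= `|v0| + 1.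
  by rewrite -[p.2](subKr v0); apply: (le_trans (ler_normB _ _)); rewrite lerD2l.
apply: (le_trans (ler_normD _ _)).
apply: (le_trans (lerD (leB _ _) (leB _ _))).
apply: (@le_trans _ _ (e / k * (`|v0| + 1) + `|u0| * (e / k))).
  by rewrite lerD// ler_pM.
rewrite [X in _ + X]mulrC -mulrDr mulrAC ler_pdivrMr// ler_pM2l// /k; lra.
Unshelve. all: by end_near. Qed.

Section ComplexPlane.
Context {R : realType}.
Local Notation C := (Rcomplex R).
Implicit Types z w : C.

(** A name of its own for the product of [Rcomplex R], so that it can carry the
    structure of a bilinear map over [R]. *)
Definition cmul z w : C := z * w.

Lemma cmul_is_bilinear :
  bilinear_for (GRing.Scale.Law.clone _ _ *:%R _)
    (GRing.Scale.Law.clone _ _ *:%R _) cmul.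
Proof.
split=> [w|w] a x y /=; rewrite /cmul.
- by rewrite mulrDl scalerAl.
- by rewrite ![w * _]mulrC mulrDl scalerAl.
Qed.
HB.instance Definition _ :=
  bilinear_isBilinear.Build R C C C _ _ cmul cmul_is_bilinear.

Definition herm z w : C := z * conjC w.

Lemma herm_is_bilinear :
  bilinear_for (GRing.Scale.Law.clone _ _ *:%R _)
    (GRing.Scale.Law.clone _ _ *:%R _) herm.
Proof.
split=> [w|w] a x y /=; rewrite /herm.
- by rewrite mulrDl scalerAl.
- by rewrite /conjC (linearP (@conjc R : C -> C)) ![w * _]mulrC mulrDl scalerAl.
Qed.
HB.instance Definition _ :=
  bilinear_isBilinear.Build R C C C _ _ herm herm_is_bilinear.

Lemma normCM z w : `|(z * w : C)| = `|z| * `|w|.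
Proof. exact: Normc.normcM. Qed.

Lemma normC_conj z : `|conjC z| = `|z|.
Proof. by case: z => a b; rewrite /Num.norm/= sqrrN. Qed.

Lemma cmul_continuous : continuous (fun p : C * C => cmul p.1 p.2).
Proof.
apply: (@bounded_bilinear_continuous R C C C cmul) => u v.
by rewrite /cmul normCM.
Qed.

Lemma herm_continuous : continuous (fun p : C * C => herm p.1 p.2).
Proof.
apply: (@bounded_bilinear_continuous R C C C herm) => u v.
by rewrite normCM normC_conj.
Qed.
End ComplexPlane.

(** * Products of a function of t and a function of s *)

Section Separated.
Context {R : realType}.
Local Notation C := (Rcomplex R).
Implicit Types (a g : R -> C) (p u v : R * R).

Lemma mulCZr (k : R) (x y : C) : x * (k *: y) = k *: (x * y : C).
Proof. by rewrite mulrC -scalerAl mulrC. Qed.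

Lemma fst_continuous : continuous (@fst R R : R * R -> R).
Proof. by move=> p; exact: cvg_fst. Qed.
Lemma snd_continuous : continuous (@snd R R : R * R -> R).
Proof. by move=> p; exact: cvg_snd. Qed.

Lemma derive_dir a t (k : R) : differentiable a t -> 'D_k a t = k *: derive1 a t.
Proof. by move=> da; rewrite deriveE// diff1E. Qed.

Lemma differentiable_sep a g p :
  differentiable a p.1 -> differentiable g p.2 ->
  differentiable (fun q : R * R => a q.1 * g q.2 : C) p.
Proof.
move=> da dg; apply: (differentiable_bilin_comp cmul_continuous).
- apply: (@differentiable_comp _ _ _ _ fst a) => //.
  by apply: linear_differentiable; exact: fst_continuous.
- apply: (@differentiable_comp _ _ _ _ snd g) => //.
  by apply: linear_differentiable; exact: snd_continuous.
Qed.

Lemma derive_sep a g p u :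
  differentiable a p.1 -> differentiable g p.2 ->
  'D_u (fun q : R * R => a q.1 * g q.2 : C) p =
    u.1 *: (derive1 a p.1 * g p.2 : C) + u.2 *: (a p.1 * derive1 g p.2 : C).
Proof.
move=> da dg.
have dfst := @derive_comp_linear _ _ _ _ a fst p u fst_continuous da.
have dsnd := @derive_comp_linear _ _ _ _ g snd p u snd_continuous dg.
rewrite (derive_bilin cmul_continuous).
- rewrite dfst dsnd !derive_dir// /cmul/=.
  by rewrite scalerAl; congr (_ + _); exact: mulCZr.
- apply: (@differentiable_comp _ _ _ _ fst a) => //.
  by apply: linear_differentiable; exact: fst_continuous.
- apply: (@differentiable_comp _ _ _ _ snd g) => //.
  by apply: linear_differentiable; exact: snd_continuous.
Qed.

Lemma Ck_at_sep n a g p :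
  Ck_at n a p.1 -> Ck_at n g p.2 ->
  Ck_at n (fun q : R * R => a q.1 * g q.2 : C) p.
Proof.
move=> ca cg; apply: (Ck_at_bilin cmul_continuous).
- exact: (@Ck_at_comp_linear _ _ _ _ _ a fst p fst_continuous).
- exact: (@Ck_at_comp_linear _ _ _ _ _ g snd p snd_continuous).
Qed.

End Separated.

(** * Euclidean, hermitian and symplectic products *)

Section Algebra.
Context {R : realType}.
Local Notation C := (Rcomplex R).
Implicit Types (a b z w x y : C) (X Y Z : C * C).

Lemma normC2 z : `|z| ^+ 2 = cdot z z.
Proof.
case: z => a b; rewrite /Num.norm/= sqr_sqrtr ?addr_ge0 ?sqr_ge0//.
by rewrite /cdot/=; ring.
Qed.

Lemma cdotC z w : cdot z w = cdot w z.
Proof. by case: z w => [a b] [c d]; rewrite /cdot/=; ring. Qed.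

Lemma cdotJC z w : cdot z (cJ w) = - cdot w (cJ z).
Proof. by case: z w => [a b] [c d]; rewrite /cdot/cJ/=; ring. Qed.

Lemma cdotJJ z : cdot z (cJ z) = 0.
Proof. by case: z => [a b]; rewrite /cdot/cJ/=; ring. Qed.

Lemma cdotM a b z w :
  cdot (a * z) (b * w) =
  cdot a b * cdot z w - cdot a (cJ b) * cdot z (cJ w).
Proof.
by case: a b z w => [? ?] [? ?] [? ?] [? ?]; rewrite /cdot/cJ/=; ring.
Qed.

Lemma cdotMJ a b z w :
  cdot (a * z) (cJ (b * w)) =
  cdot a b * cdot z (cJ w) + cdot a (cJ b) * cdot z w.
Proof.
by case: a b z w => [? ?] [? ?] [? ?] [? ?]; rewrite /cdot/cJ/=; ring.
Qed.

(** The hermitian product has [cdot] and [cdot _ (cJ _)] as real and imaginary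
    parts, so complex identities become pairs of identities between real scalars,
    on which [cdotM] and [cdotMJ] compute. *)
Lemma hermE z w : herm z w = Complex (cdot z w) (cdot z (cJ w)).
Proof.
by case: z w => [? ?] [? ?]; rewrite /herm/cdot/cJ/=; congr Complex; ring.
Qed.

Lemma dotE X Y : dot X Y = cdot X.1 Y.1 + cdot X.2 Y.2.
Proof. by case: X Y => [[? ?] [? ?]] [[? ?] [? ?]]. Qed.

Lemma dotC X Y : dot X Y = dot Y X.
Proof. by rewrite !dotE cdotC [cdot X.2 _]cdotC. Qed.

Lemma cdotDl k z l w x : cdot (k *: z + l *: w) x = k * cdot z x + l * cdot w x.
Proof. by case: z w x => [? ?] [? ?] [? ?]; rewrite /cdot/=; ring. Qed.

Lemma dotDl (k l : R) X Y Z :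
  dot (k *: X + l *: Y) Z = k * dot X Z + l * dot Y Z.
Proof. by rewrite !dotE/= !cdotDl; ring. Qed.

Lemma dotDr (k l : R) X Y Z :
  dot Z (k *: X + l *: Y) = k * dot Z X + l * dot Z Y.
Proof. by rewrite dotC dotDl ![dot _ Z]dotC. Qed.

Lemma JD (k l : R) X Y : J (k *: X + l *: Y) = k *: J X + l *: J Y.
Proof.
have cJD z w : cJ (k *: z + l *: w) = k *: cJ z + l *: cJ w.
  by case: z w => [? ?] [? ?]; congr Complex => /=; ring.
by rewrite /J/= !cJD.
Qed.

Lemma omegaE X Y : omega X Y = - dot X (J Y).
Proof.
case: X Y => [[? ?] [? ?]] [[? ?] [? ?]]; rewrite /omega/dot/hprod/J/cJ/=; ring.
Qed.

Lemma omega_frame X Y (a b c d : R) :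
  omega (a *: X + b *: Y) (c *: X + d *: Y) = (b * c - a * d) * dot X (J Y).
Proof.
have JJ Z : dot Z (J Z) = 0 by rewrite dotE !cdotJJ addr0.
have XJY : dot X (J Y) = - dot Y (J X).
  by rewrite !dotE/= cdotJC [cdot X.2 _]cdotJC opprD.
by rewrite omegaE JD dotDl !dotDr !JJ XJY; ring.
Qed.

(** The two ways in which a common factor of the two vectors contributes only
    its squared modulus, as [J] is complex linear. *)
Lemma dotJ_mulr x1 x2 y1 y2 z1 z2 :
  dot (x1 * z1 : C, x2 * z2 : C) (J (y1 * z1 : C, y2 * z2 : C)) =
  cdot x1 (cJ y1) * `|z1| ^+ 2 + cdot x2 (cJ y2) * `|z2| ^+ 2.
Proof. by rewrite dotE /= !cdotMJ !cdotJJ !normC2 !mulr0 !add0r. Qed.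

Lemma dotJ_mull x1 x2 y1 y2 z1 z2 :
  dot (z1 * x1 : C, z2 * x2 : C) (J (z1 * y1 : C, z2 * y2 : C)) =
  `|z1| ^+ 2 * cdot x1 (cJ y1) + `|z2| ^+ 2 * cdot x2 (cJ y2).
Proof.
by rewrite dotE /= !cdotMJ !cdotJJ !normC2 !mul0r !addr0.
Qed.

Lemma dotxx_eq0 X : dot X X = 0 -> X = 0.
Proof.
case: X => [[a b] [c d]]; rewrite /dot/hprod/= => h.
have [a0 [b0 [c0 d0]]] : a = 0 /\ b = 0 /\ c = 0 /\ d = 0 by nra.
by rewrite a0 b0 c0 d0.
Qed.

Lemma dot0r X : dot X 0 = 0.
Proof. by case: X => [[? ?] [? ?]]; rewrite /dot/hprod/=; ring. Qed.

End Algebra.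

(** * The cubic form of a Lagrangian conformal map *)

Section Surface.
Context {R : realType}.
Local Notation C := (Rcomplex R).

Lemma diff_dtds (phi : R * R -> C * C) p u :
  'd phi p u = u.1 *: 'd phi p dt + u.2 *: 'd phi p ds.
Proof.
rewrite -!linearZ -linearD; congr ('d phi p _).
by apply: injective_projections;
  rewrite /= /GRing.scale/= ?mulr1 ?mulr0 ?addr0 ?add0r.
Qed.

(** [x - 'd phi p c] is normal to the tangent plane when [c] holds the components
    of [x] on the frame divided by [l].  If [l = 0] the differential is zero and
    every [c] will do.  The
    tangential part of [x] does not contribute to the cubic form, because [J]
    maps tangent vectors to normal ones. *)
Lemma cubic_form_conformal (phi : R * R -> C * C) p (l : R) u v w :
  (forall u v, omega ('d phi p u) ('d phi p v) = 0) ->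
  (forall u v, induced_metric phi p u v = l * (u.1 * v.1 + u.2 * v.2)) ->
  cubic_form phi p u v w =
    dot ('D_u (fun q => 'd phi q v) p) (J ('d phi p w)).
Proof.
move=> lag conf; rewrite /cubic_form /second_fundamental_form /normal_part.
set x := 'D_u _ p.
have [] := @xgetPex _ 0 [set n : C * C |
    (forall u, dot n ('d phi p u) = 0) /\ (exists u, x = n + 'd phi p u)].
  pose c : R * R := (dot x ('d phi p dt) / l, dot x ('d phi p ds) / l).
  exists (x - 'd phi p c); split; last by exists c; rewrite subrK.
  move=> z; have [l0|l0] := eqVneq l 0.
    suff -> : 'd phi p z = 0 by exact: dot0r.
    apply: dotxx_eq0; rewrite -/(induced_metric phi p z z) conf l0; ring.
  have := conf c z; rewrite /induced_metric => cz.
  rewrite -{1}[x]scale1r -scaleN1r dotDl cz (diff_dtds _ _ z) dotDr /c/=.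
  by field.
set n := xget _ _ => _ [z xE].
have : dot x (J ('d phi p w)) = dot n (J ('d phi p w)).
  rewrite xE -[n in LHS]scale1r -['d phi p z]scale1r dotDl.
  have := lag z w; rewrite omegaE => /eqP; rewrite oppr_eq0 => /eqP ->.
  by ring.
by move=> ->.
Qed.

End Surface.

(** * Relations along Legendre curves *)

Section LegendreRelations.
Context {R : realType}.
Local Notation C := (Rcomplex R).
Implicit Types g a : R -> C.

(** With [u = |g1|^2] and [v = |g1'|^2], the moduli in the Legendre condition give
    [v * u = (1 - v) * (1 - u)], that is [v = 1 - u]. *)
Lemma legendre_S3_relations I g1 g2 s :
  unit_speed_legendre_S3 I g1 g2 -> I s ->
  [/\ `|g1 s| ^+ 2 + `|g2 s| ^+ 2 = 1,
      `|derive1 g1 s| ^+ 2 = `|g2 s| ^+ 2, `|derive1 g2 s| ^+ 2 = `|g1 s| ^+ 2,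
      cdot (derive1 g1 s) (g1 s) + cdot (derive1 g2 s) (g2 s) = 0 &
      cdot (derive1 g1 s) (cJ (g1 s)) + cdot (derive1 g2 s) (cJ (g2 s)) = 0].
Proof.
move=> [_ _ /[apply]] [n1 n1' leg].
have /(congr1 (fun z : C => `|z| ^+ 2)) :
    derive1 g1 s * conjC (g1 s) = - (derive1 g2 s * conjC (g2 s)) :> C.
  by apply/eqP; rewrite -addr_eq0; apply/eqP.
rewrite normrN !normCM !normC_conj !exprMn => nE.
have := leg; rewrite -/(herm _ _) -/(herm (derive1 g2 s) _) !hermE => -[re im].
by split => //; nra.
Qed.

(** With [u = |a1|^2] and [v = |a2'|^2], the moduli in the Legendre condition give
    [(1 + v) * u = v * (1 + u)], that is [v = u]. *)
Lemma legendre_H31_relations I a1 a2 t :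
  unit_speed_legendre_H31 I a1 a2 -> I t ->
  [/\ `|a2 t| ^+ 2 = `|a1 t| ^+ 2 + 1,
      `|derive1 a1 t| ^+ 2 = `|a2 t| ^+ 2, `|derive1 a2 t| ^+ 2 = `|a1 t| ^+ 2,
      cdot (derive1 a1 t) (a1 t) = cdot (derive1 a2 t) (a2 t) &
      cdot (derive1 a1 t) (cJ (a1 t)) = cdot (derive1 a2 t) (cJ (a2 t))].
Proof.
move=> [_ _ /[apply]] [n1 n1' leg].
have hE : herm (derive1 a1 t) (a1 t) = herm (derive1 a2 t) (a2 t).
  by apply/eqP; rewrite -subr_eq0; apply/eqP.
have /(congr1 (fun z : C => `|z| ^+ 2)) := hE.
rewrite !normCM !normC_conj !exprMn => nE.
move: hE; rewrite !hermE => -[re im].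
by split => //; nra.
Qed.

(** Real and imaginary parts of the derivative
    [a1'' conj(a1) + |a1'|^2 - (a2'' conj(a2) + |a2'|^2) = 0] of the Legendre
    condition, with [|a1'|^2 - |a2'|^2 = 1]. *)
Lemma legendre_H31_second I a1 a2 t :
  nondegenerate_interval I -> unit_speed_legendre_H31 I a1 a2 -> I t ->
  cdot (derive1 (derive1 a1) t) (a1 t) + 1 =
    cdot (derive1 (derive1 a2) t) (a2 t) /\
  cdot (derive1 (derive1 a1) t) (cJ (a1 t)) =
    cdot (derive1 (derive1 a2) t) (cJ (a2 t)).
Proof.
move=> HI [sa1 sa2 leg] It.
have d1 := Ck_at1_diff (sa1 t It 1); have d2 := Ck_at1_diff (sa2 t It 1).
have dd1 := Ck_at1_diff (Ck_at_derive1 (sa1 t It 2)).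
have dd2 := Ck_at1_diff (Ck_at_derive1 (sa2 t It 2)).
pose h x := herm (derive1 a1 x) (a1 x) - herm (derive1 a2 x) (a2 x).
have dh1 := differentiable_bilin_comp herm_continuous dd1 d1.
have dh2 := differentiable_bilin_comp herm_continuous dd2 d2.
have /(derive1_eq0_interval HI It) : forall x, I x -> h x = 0.
  by move=> x /leg[_ _].
have dh : derivable h t 1.
  by apply: diff_derivable; exact: differentiableB dh1 dh2.
move=> /(_ dh); rewrite derive1E.
rewrite (@deriveB _ _ _ (fun x => herm (derive1 a1 x) (a1 x))
    (fun x => herm (derive1 a2 x) (a2 x)));
  [|exact: diff_derivable dh1|exact: diff_derivable dh2].
rewrite !(derive_bilin herm_continuous)// -!derive1E /= !hermE => -[re im].
have [_ /eqP nE _] := leg t It; move: nE; rewrite !normC2 => /eqP nE.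
by rewrite !cdotJJ in im; split; lra.
Qed.

End LegendreRelations.

(** * The product of two curves *)

Section ProductMap.
Context {R : realType}.
Local Notation C := (Rcomplex R).
Implicit Types (a g : R -> C) (p u v : R * R).

Definition product_map a1 a2 g1 g2 p : C * C :=
  (a1 p.1 * g1 p.2, a2 p.1 * g2 p.2).

Lemma Ck_at_product_map n a1 a2 g1 g2 p :
  Ck_at n a1 p.1 -> Ck_at n a2 p.1 -> Ck_at n g1 p.2 -> Ck_at n g2 p.2 ->
  Ck_at n (product_map a1 a2 g1 g2) p.
Proof. by move=> ? ? ? ?; apply: Ck_at_pair; exact: Ck_at_sep. Qed.

Lemma differentiable_product_map a1 a2 g1 g2 p :
  differentiable a1 p.1 -> differentiable a2 p.1 ->
  differentiable g1 p.2 -> differentiable g2 p.2 ->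
  differentiable (product_map a1 a2 g1 g2) p.
Proof.
by move=> ? ? ? ?; apply: differentiable_pair; exact: differentiable_sep.
Qed.

Lemma diff_product_map a1 a2 g1 g2 p v :
  differentiable a1 p.1 -> differentiable a2 p.1 ->
  differentiable g1 p.2 -> differentiable g2 p.2 ->
  'd (product_map a1 a2 g1 g2) p v =
    v.1 *: product_map (derive1 a1) (derive1 a2) g1 g2 p +
    v.2 *: product_map a1 a2 (derive1 g1) (derive1 g2) p.
Proof.
move=> da1 da2 dg1 dg2.
have d1 := differentiable_sep da1 dg1; have d2 := differentiable_sep da2 dg2.
rewrite -deriveE; last exact: differentiable_product_map.
by rewrite derive_pair// !derive_sep.
Qed.

(** Differentiating a product map yields product maps, so [diff_product_map]
    applies a second time. *)
Lemma derive2_product_map a1 a2 g1 g2 p u v :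
  Ck_at 2 a1 p.1 -> Ck_at 2 a2 p.1 -> Ck_at 2 g1 p.2 -> Ck_at 2 g2 p.2 ->
  'D_u (fun q => 'd (product_map a1 a2 g1 g2) q v) p =
    v.1 *: (u.1 *: product_map (derive1 (derive1 a1)) (derive1 (derive1 a2))
                     g1 g2 p +
            u.2 *: product_map (derive1 a1) (derive1 a2)
                     (derive1 g1) (derive1 g2) p) +
    v.2 *: (u.1 *: product_map (derive1 a1) (derive1 a2)
                     (derive1 g1) (derive1 g2) p +
            u.2 *: product_map a1 a2
                     (derive1 (derive1 g1)) (derive1 (derive1 g2)) p).
Proof.
move=> ca1 ca2 cg1 cg2.
have [na1 _] := ca1; have [na2 _] := ca2.
have [ng1 _] := cg1; have [ng2 _] := cg2.
have da1 := nbhs_singleton na1; have da2 := nbhs_singleton na2.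
have dg1 := nbhs_singleton ng1; have dg2 := nbhs_singleton ng2.
have dda1 := Ck_at1_diff (Ck_at_derive1 ca1).
have dda2 := Ck_at1_diff (Ck_at_derive1 ca2).
have ddg1 := Ck_at1_diff (Ck_at_derive1 cg1).
have ddg2 := Ck_at1_diff (Ck_at_derive1 cg2).
pose X := product_map (derive1 a1) (derive1 a2) g1 g2.
pose Y := product_map a1 a2 (derive1 g1) (derive1 g2).
have dX : differentiable X p by exact: differentiable_product_map.
have dY : differentiable Y p by exact: differentiable_product_map.
have fstP (P : set R) : (\forall x \near p.1, P x) -> \forall q \near p, P q.1.
  by move=> nP; exact: (@fst_continuous R p _ nP).
have sndP (P : set R) : (\forall x \near p.2, P x) -> \forall q \near p, P q.2.
  by move=> nP; exact: (@snd_continuous R p _ nP).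
have -> : 'D_u (fun q => 'd (product_map a1 a2 g1 g2) q v) p =
    'D_u (fun q => v.1 *: X q + v.2 *: Y q) p.
  apply: near_eq_derive; near=> q; apply: diff_product_map; near: q;
    [exact: fstP na1|exact: fstP na2|exact: sndP ng1|exact: sndP ng2].
rewrite (@deriveD _ _ _ (fun q => v.1 *: X q) (fun q => v.2 *: Y q));
  [|exact: diff_derivable (differentiableZ _ dX)
   |exact: diff_derivable (differentiableZ _ dY)].
rewrite !deriveZ; [|exact: diff_derivable dY|exact: diff_derivable dX].
rewrite (deriveE _ dX) (deriveE _ dY).
congr (_ *: _ + _ *: _).
- exact: (diff_product_map u dda1 dda2 dg1 dg2).
- exact: (diff_product_map u da1 da2 ddg1 ddg2).
Unshelve. all: by end_near. Qed.

(** The complex numbers stand for [a1''], [a1], [g1], [g1'] and their analogues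
    at one point: the hypotheses are the [gamma] Legendre condition and the
    differentiated [alpha] one.  With [q = g1' conj(g1)] the [gamma]-factors are
    [conj(q)] and [- conj(q)], so that the [alpha]-factors combine into
    [a1'' conj(a1) - a2'' conj(a2) = -1] and the imaginary part of [q] remains. *)
Lemma dotJ_second_mixed (x1 x2 y1 y2 z1 z2 w1 w2 : C) :
  cdot w1 z1 + cdot w2 z2 = 0 -> cdot w1 (cJ z1) + cdot w2 (cJ z2) = 0 ->
  cdot x1 y1 + 1 = cdot x2 y2 -> cdot x1 (cJ y1) = cdot x2 (cJ y2) ->
  dot (x1 * z1 : C, x2 * z2 : C) (J (y1 * w1 : C, y2 * w2 : C)) =
  cdot w1 (cJ z1).
Proof.
move=> re im xy xJy; rewrite dotE /= !cdotMJ xJy -xy.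
rewrite (cdotJC z1) (cdotJC z2) (cdotC z1) (cdotC z2).
have -> : cdot w1 z1 = - cdot w2 z2 by lra.
have -> : cdot w1 (cJ z1) = - cdot w2 (cJ z2) by lra.
by ring.
Qed.

(** Both [|X|^2] and [|Y|^2] equal [|a2|^2 |g1|^2 + |a1|^2 |g2|^2], and
    [|a2|^2 = |a1|^2 + 1], [|g2|^2 = 1 - |g1|^2]. *)
Lemma product_map_frame a1 a2 g1 g2 I1 I2 t s :
  unit_speed_legendre_S3 I1 g1 g2 -> unit_speed_legendre_H31 I2 a1 a2 ->
  I2 t -> I1 s ->
  let X := product_map (derive1 a1) (derive1 a2) g1 g2 (t, s) in
  let Y := product_map a1 a2 (derive1 g1) (derive1 g2) (t, s) in
  [/\ dot X X = `|g1 s| ^+ 2 + `|a1 t| ^+ 2,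
      dot Y Y = `|g1 s| ^+ 2 + `|a1 t| ^+ 2,
      dot X Y = 0 & dot X (J Y) = 0].
Proof.
move=> hg ha It Is X Y.
have [gN g1' g2' gr gi] := legendre_S3_relations hg Is.
have [aN a1' a2' ar ai] := legendre_H31_relations ha It.
rewrite /X /Y /J /product_map !dotE /= !cdotMJ !cdotM !cdotJJ -!normC2 g1' g2' a1' a2' aN.
have -> : `|g2 s| ^+ 2 = 1 - `|g1 s| ^+ 2 by rewrite -gN; ring.
rewrite !(cdotJC (g1 s)) !(cdotJC (g2 s)) !(cdotC (g1 s)) !(cdotC (g2 s)).
have gr1 : cdot (derive1 g1 s) (g1 s) = - cdot (derive1 g2 s) (g2 s) by lra.
have gi1 : cdot (derive1 g1 s) (cJ (g1 s)) = - cdot (derive1 g2 s) (cJ (g2 s)) by lra.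
by rewrite ar ai gr1 gi1; split; ring.
Qed.
End ProductMap.

Theorem proposition2p1 (R : realType) (I1 I2 : set R)
    (gamma1 gamma2 alpha1 alpha2 : R -> Rcomplex R)
    (hI1 : nondegenerate_interval I1) (hI2 : nondegenerate_interval I2)
    (hgamma : unit_speed_legendre_S3 I1 gamma1 gamma2)
    (halpha : unit_speed_legendre_H31 I2 alpha1 alpha2) :
  let phi : R * R -> Rcomplex R * Rcomplex R := fun p =>
    (alpha1 p.1 * gamma1 p.2, alpha2 p.1 * gamma2 p.2) in
  let D : set (R * R) := I2 `*` I1 in
  (* the points of D where the conformal factor does not vanish *)
  let Dreg : set (R * R) :=
    D `&` [set p | ~ (alpha1 p.1 = 0 /\ gamma1 p.2 = 0)] in
  [/\ smooth_on D phi /\ lagrangian_on D phi,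
      immersion_on Dreg phi /\ conformal_on Dreg phi,
      forall t s, D (t, s) -> forall u v : R * R,
        induced_metric phi (t, s) u v =
        (`|gamma1 s| ^+ 2 + `|alpha1 t| ^+ 2) * (u.1 * v.1 + u.2 * v.2) &
      forall t s, D (t, s) ->
      [/\ cubic_form phi (t, s) dt dt dt =
            cdot (alpha1^`(2) t) (cJ (alpha1^`() t)) * `|gamma1 s| ^+ 2 +
            cdot (alpha2^`(2) t) (cJ (alpha2^`() t)) * `|gamma2 s| ^+ 2,
          cubic_form phi (t, s) dt dt ds =
            cdot (gamma1^`() s) (cJ (gamma1 s)),
          cubic_form phi (t, s) dt ds ds =
            cdot (alpha1^`() t) (cJ (alpha1 t)) &
          cubic_form phi (t, s) ds ds ds =
            `|alpha1 t| ^+ 2 * cdot (gamma1^`(2) s) (cJ (gamma1^`() s)) +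
            `|alpha2 t| ^+ 2 * cdot (gamma2^`(2) s) (cJ (gamma2^`() s))]].
Proof.
move=> phi D Dreg.
have Ck t s : D (t, s) -> forall n,
    [/\ Ck_at n alpha1 t, Ck_at n alpha2 t, Ck_at n gamma1 s & Ck_at n gamma2 s].
  case: hgamma halpha => [sg1 sg2 _] [sa1 sa2 _] [/= It Is] n.
  by split; [exact: sa1|exact: sa2|exact: sg1|exact: sg2].
pose X t s := product_map (derive1 alpha1) (derive1 alpha2) gamma1 gamma2 (t, s).
pose Y t s := product_map alpha1 alpha2 (derive1 gamma1) (derive1 gamma2) (t, s).
have dphi t s : D (t, s) -> forall v,
    'd phi (t, s) v = v.1 *: X t s + v.2 *: Y t s.
  move=> /Ck /(_ 1)[ca1 ca2 cg1 cg2] v; apply: diff_product_map.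
  - exact: Ck_at1_diff ca1.
  - exact: Ck_at1_diff ca2.
  - exact: Ck_at1_diff cg1.
  - exact: Ck_at1_diff cg2.
have smooth : smooth_on D phi.
  move=> [t s] /Ck Dts n; have [ca1 ca2 cg1 cg2] := Dts n.
  exact: (Ck_at_product_map (p := (t, s)) ca1 ca2 cg1 cg2).
have lag : lagrangian_on D phi.
  move=> [t s] Dts u v; rewrite !dphi//.
  have [_ _ _ XJY] := product_map_frame hgamma halpha Dts.1 Dts.2.
  by rewrite omega_frame XJY mulr0.
have metric t s : D (t, s) -> forall u v : R * R,
    induced_metric phi (t, s) u v =
    (`|gamma1 s| ^+ 2 + `|alpha1 t| ^+ 2) * (u.1 * v.1 + u.2 * v.2).
  move=> Dts u v; rewrite /induced_metric !dphi//.
  have [XX YY XY _] := product_map_frame hgamma halpha Dts.1 Dts.2.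
  have YX := XY; rewrite dotC in YX.
  by rewrite dotDl !dotDr XX YY XY YX; ring.
have factor_gt0 t s : Dreg (t, s) -> 0 < `|gamma1 s| ^+ 2 + `|alpha1 t| ^+ 2.
  move=> [_ /= reg]; rewrite lt_neqAle addr_ge0 ?sqr_ge0// andbT eq_sym.
  rewrite paddr_eq0 ?sqr_ge0// !sqrf_eq0 !normr_eq0.
  by apply/negP => /andP[/eqP g0 /eqP a0]; exact: reg.
split => //; first split.
- split=> [p [Dp _]|[t s] Dts u v duv]; first exact: smooth.
  have /eqP := metric t s Dts.1 (u - v) (u - v).
  rewrite /induced_metric linearB /= duv subrr dot0r eq_sym mulf_eq0.
  rewrite gt_eqF ?factor_gt0//= -!expr2 paddr_eq0 ?sqr_ge0// !sqrf_eq0.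
  rewrite !subr_eq0 => /andP[/eqP u1 /eqP u2].
  exact: injective_projections.
- move=> [t s] Dts; exists (`|gamma1 s| ^+ 2 + `|alpha1 t| ^+ 2).
    exact: factor_gt0.
  exact: metric Dts.1.
move=> t s Dts; have It : I2 t := Dts.1; have Is : I1 s := Dts.2.
rewrite !(cubic_form_conformal _ _ _ (lag _ Dts) (metric _ _ Dts)).
have [ca1 ca2 cg1 cg2] := Ck t s Dts 2.
rewrite !(derive2_product_map (p := (t, s)) _ _ ca1 ca2 cg1 cg2) !dphi//=.
rewrite !scale1r !scale0r !add0r !addr0.
have [gN g1' g2' gr gi] := legendre_S3_relations hgamma Is.
have [_ _ _ _ ai] := legendre_H31_relations halpha It.
have [ar2 ai2] := legendre_H31_second hI2 halpha It.
split.
- exact: dotJ_mulr.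
- exact: dotJ_second_mixed.
- by rewrite dotJ_mulr g1' g2' /= -ai -mulrDr [X in _ * X]addrC gN mulr1.
- exact: dotJ_mull.
Qed.
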